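(* Let $X$ be a non-separable metric space. Then there exists an exceedingly rich family $\mathcal{S}$ of closed subsets of $X$ such that for every $Y\in\mathcal{S}$: $X$ is an absolute ai-local retract if and only if $Y$ (with the restricted metric) is an absolute ai-local retract.
   Context: For a topological space $Z$, $\operatorname{dens}Z$ is the least cardinality of a dense subset, and $\omega$ is the first infinite cardinal. A nonempty family $\mathcal{A}$ of sets is up-directed if for all $A,B\in\mathcal{A}$ there is $C\in\mathcal{A}$ with $A\cup B\subset C$. A family $\mathcal{S}$ of closed subsets of a topological space $X$ is exceedingly rich if: (R-a) for every $Y\subset X$ there is $S\in\mathcal{S}$ with $Y\subset S$ and $\max\{\operatorname{dens}Y,\omega\}=\operatorname{dens}S$; (R-b) if $\mathcal{A}\subset\mathcal{S}$ is up-directed, then $\overline{\bigcup\mathcal{A}}\in\mathcal{S}$. A subset $Y$ of a metric space $(M,d)$ is an almost isometric local retract (ai-local retract) in $M$ if for every finite set $E\subset M$ and every $\varepsilon>0$ there is a map $T:E\to Y$ such that $Tx=x$ for $x\in E\cap Y$ and $(1+\varepsilon)^{-1}d(x,y)\le d(Tx,Ty)\le(1+\varepsilon)d(x,y)$ for all $x,y\in E$. A metric space is an absolute ai-local retract if it is an ai-local retract in every metric space containing it (isometrically, as a metric subspace). *)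

(* Defs.v *)
From HB Require Import structures.
From mathcomp Require Import all_boot all_order all_algebra.
From mathcomp Require Import all_classical all_reals all_analysis.

Set Implicit Arguments.
Unset Strict Implicit.
Unset Printing Implicit Defensive.

Import Order.TTheory GRing.Theory Num.Theory.
Local Open Scope classical_set_scope.
Local Open Scope card_scope.
Local Open Scope ring_scope.

(* The restricted metric on a subset. [set_type A] already carries the induced
   pseudometric structure (hence the subspace topology) in the library. *)
Section restricted_metric.
Context {R : realType} {X : metricType R} (A : set X).

Let dist (x y : A) : R := mdist (\val x) (\val y).

Let dist_ge0 (x y : A) : 0 <= dist x y.
Proof. exact: mdist_ge0. Qed.

Let dist_positivity (x y : A) : dist x y = 0 -> x = y.
Proof. by move=> /mdist_positivity/val_inj. Qed.

Let ballEdist (x : A) (e : R) : ball x e = [set y | dist x y < e].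
Proof. by rewrite -initial_ballE ballEmdist. Qed.

HB.instance Definition _ :=
  @PseudoMetric_isMetric.Build R (set_type A) dist
    dist_ge0 dist_positivity ballEdist.

End restricted_metric.

(* Cardinal numbers are handled through sets representing them, compared with
   [#<=]: [realizes_dens D] says that D is a dense subset of Z of cardinality
   dens Z. *)
Definition realizes_dens (Z : topologicalType) (D : set Z) : Prop :=
  dense D /\ forall D' : set Z, dense D' -> D #<= D'.

(* |C| = max (|A|, |B|) *)
Definition is_card_max (T U V : Type) (A : set T) (B : set U) (C : set V) : Prop :=
  [/\ A #<= C, B #<= C & C #<= A \/ C #<= B].

Definition separable (Z : topologicalType) : Prop :=
  exists2 D : set Z, countable D & dense D.

Definition up_directed (T : Type) (A : set (set T)) : Prop :=
  A !=set0 /\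
  forall B C, A B -> A C -> exists2 D, A D & B `|` C `<=` D.

(* Y and S, coerced to types, carry the subspace topology; the middle clause
   reads max {dens Y, omega} = dens S. *)
Definition exceedingly_rich (X : topologicalType) (F : set (set X)) : Prop :=
  [/\ forall S, F S -> closed S,
      forall Y : set X, exists S : set X,
        [/\ F S, Y `<=` S &
            exists (DY : set Y) (DS : set S),
              [/\ realizes_dens DY, realizes_dens DS &
                  is_card_max DY [set: nat] DS]] &
      forall A : set (set X), A `<=` F -> up_directed A ->
        F (closure (\bigcup_(B in A) B))].

(* T : E -> Y is given by its values on E; those outside E are irrelevant. *)
Definition ai_local_retract (R : realType) (M : metricType R) (Y : set M) : Prop :=
  forall (E : set M) (eps : R), finite_set E -> 0 < eps ->
    exists T : M -> M,
      [/\ set_fun E Y T,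
          forall x, (E `&` Y) x -> T x = x &
          forall x y, E x -> E y ->
            (1 + eps)^-1 * mdist x y <= mdist (T x) (T y)
              <= (1 + eps) * mdist x y].

Definition isometric_embedding (R : realType) (X M : metricType R)
    (f : X -> M) : Prop :=
  forall x y, mdist (f x) (f y) = mdist x y.

(* Metric spaces containing X are given up to isometry, as metric spaces M with
   an isometric embedding of X. *)
Definition absolute_ai_local_retract (R : realType) (X : metricType R) : Prop :=
  forall (M : metricType R) (f : X -> M), isometric_embedding f ->
    ai_local_retract (range f).

(* Main.v *)
Require Import Defs.
From HB Require Import structures.
From mathcomp Require Import all_boot all_order all_algebra.
From mathcomp Require Import all_classical all_reals all_analysis.
From mathcomp Require Import ring lra.

(* If X is not an absolute ai-local retract, this is witnessed by one finite set
   E in one superspace, and the same E witnesses the failure for every closed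
   Y containing the finite set E `&` X: these Y form the family.

   If X is an absolute ai-local retract, then so is every closed ai-local
   retract Y of X: given a superspace M of Y, glue X and M along Y, retract a
   finite subset of M into X, then its image into Y. The family consists of the
   closed Y that are ai-local retracts of X up to a small additive error. Such
   sets are obtained by a Skolem hull, since the finite configurations over a
   finite set need only be realized up to rounding of their distances, hence
   have countably many types; closures of up-directed unions are handled by
   perturbing the finite set.

   Controlling the density of the hulls needs that cardinals are well-ordered
   and that K * K <= K for infinite K. *)

Set Implicit Arguments.
Unset Strict Implicit.
Unset Printing Implicit Defensive.

Import Order.TTheory GRing.Theory Num.Theory.
Local Open Scope classical_set_scope.
Local Open Scope card_scope.

(** * Cardinals *)

Lemma card_le_set_inj (T U : Type) (A : set T) (B : set U) (f : T -> U) :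
  set_fun A B f -> set_inj A f -> A #<= B.
Proof.
move=> fAB finj; apply: (@card_le_trans _ _ _ (f @` A)).
  by have /card_esym := inj_card_eq finj; rewrite card_eq_le => /andP[].
by apply: subset_card_le => _ [x Ax <-]; exact: fAB.
Qed.

Lemma card_le_injfun (T U : Type) (A : set T) (B : set U) : U -> A #<= B ->
  exists2 f : T -> U, set_fun A B f & set_inj A f.
Proof.
move=> u; elim/Ppointed: U => U in B u *; first by have := no u.
by move=> /pcard_leP; rewrite injfunPex.
Qed.

(* Zorn's lemma on the sets R of choice functions on P whose elements differ at
   each member of P: a maximal R exhausts some D in P. *)
Lemma card_le_min (T : Type) (P : set (set T)) : P !=set0 ->
  exists2 D, P D & forall D', P D' -> D #<= D'.
Proof.
move=> [D0 PD0].
pose Q (R : set (set T -> T)) :=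
  (forall r D, R r -> P D -> D (r D)) /\
  (forall r s D, R r -> R s -> P D -> r D = s D -> r = s).
have [F FQ totF|R [[Rin Rinj] Rmax]] := @Zorn_bigcup _ Q.
  split=> [r D [S FS Sr] PD|r s D [S FS Sr] [S' FS' Ss] PD].
    by have [/(_ _ _ Sr PD)] := FQ _ FS.
  by have [SS'|S'S] := totF _ _ FS FS';
    [apply: (FQ _ FS').2 => //; exact: SS'|apply: (FQ _ FS).2 => //; exact: S'S].
have [D PD Dsurj] : exists2 D, P D & forall x, D x -> exists2 r, R r & r D = x.
  apply: contrapT => noD.
  have /choice[r0 r0P] : forall D, exists x, P D ->
      D x /\ forall r, R r -> r D <> x.
    move=> D; have [PD|nPD] := pselect (P D); last first.
      have [[x _]|T0] := pselect (exists x : T, True); first by exists x.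
      exfalso; apply: noD; exists D0 => // x _; case: T0; by exists x.
    apply: contrapT => nx; apply: noD; exists D => // x Dx.
    apply: contrapT => nr; apply: nx; exists x => _; split=> // r Rr rx.
    by apply: nr; exists r.
  apply: (Rmax (R `|` [set r0])).
    split=> [|/(_ r0 (or_intror erefl)) Rr0]; first exact: subsetUl.
    by have [_ /(_ _ Rr0)] := r0P _ PD0.
  split=> [r D [Rr|->] PD|r s D [Rr|->] [Rs|->] PD //].
  - by have := Rin _ _ Rr PD.
  - exact: (r0P _ PD).1.
  - by move=> rs; exact: Rinj PD rs.
  - by move=> rs; have [_ /(_ _ Rr)] := r0P _ PD.
  - by move=> rs; have [_ /(_ _ Rs)] := r0P _ PD; case.
exists D => // D' PD'.
(* Evaluation at [D'] is injective on [R], while evaluation at [D] covers [D]. *)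
have RD' : R #<= D'.
  apply: (@card_le_set_inj _ _ _ _ (fun r => r D')) => [r Rr|r s /set_mem Rr /set_mem Rs].
    by have := Rin _ _ Rr PD'.
  by move=> rs; exact: Rinj PD' rs.
apply: card_le_trans RD'.
apply: card_le_trans (card_image_le (fun r => r D) R).
by apply: subset_card_le => x /Dsurj[r Rr <-]; exists r.
Qed.

(** Copying both sets into the sum type makes them members of one two-element family, whose least
    member decides the comparison. *)
Lemma card_le_total (T U : Type) (A : set T) (B : set U) : A #<= B \/ B #<= A.
Proof.
have lA : A #= (inl @` A : set (T + U)).
  by apply/card_esym/inj_card_eq => x y _ _ [].
have rB : B #= (inr @` B : set (T + U)).
  by apply/card_esym/inj_card_eq => x y _ _ [].
rewrite (card_le_eql lA) (card_le_eqr rB) (card_le_eql rB) (card_le_eqr lA).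
have [|D [->|->] Dmin] := @card_le_min (T + U) [set inl @` A; inr @` B].
- by exists (inl @` A); left.
- by left; apply: Dmin; right.
- by right; apply: Dmin; left.
Qed.

Lemma card_le_setX (T T' U U' : Type) (A : set T) (B : set U) (A' : set T')
  (B' : set U') : A #<= A' -> B #<= B' -> A `*` B #<= A' `*` B'.
Proof.
have [-> /card_le0P -> _|/set0P[a' A'a'] AA'] := eqVneq A' set0.
  by rewrite set0X.
have [-> /card_le0P ->|/set0P[b' B'b'] BB'] := eqVneq B' set0.
  by rewrite setX0.
have [f fA finj] := card_le_injfun a' AA'.
have [g gB ginj] := card_le_injfun b' BB'.
apply: (@card_le_set_inj _ _ _ _ (fun p => (f p.1, g p.2))) => [p [/fA ? /gB ?]//|].
move=> [x y] [x' y'] /set_mem[/= Ax By] /set_mem[/= Ax' By'] [].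
by move=> /(finj _ _ (mem_set Ax) (mem_set Ax')) -> /(ginj _ _ (mem_set By) (mem_set By')) ->.
Qed.

(** A point is coded by a chosen index whose member contains it, together with its code in that
    member. *)
Lemma card_bigcup_le (I T K L : Type) (D : set I) (F : I -> set T)
    (A : set K) (B : set L) :
  D #<= A -> (forall i, D i -> F i #<= B) -> \bigcup_(i in D) F i #<= A `*` B.
Proof.
move=> DA FB; have [->|/set0P[x [i Di Fx]]] := eqVneq (\bigcup_(i in D) F i) set0.
  exact: card_ge0.
have [A0|/set0P[a Aa]] := eqVneq A set0.
  by move: DA; rewrite A0 => /card_le0P D0; rewrite D0 in Di.
have [B0|/set0P[b Bb]] := eqVneq B set0.
  by have := FB i Di; rewrite B0 => /card_le0P F0; rewrite F0 in Fx.
have [f fA finj] := card_le_injfun a DA.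
have /choice[g gP] : forall i, exists g : T -> L, D i -> set_fun (F i) B g /\ set_inj (F i) g.
  move=> j; have [Dj|nDj] := pselect (D j); last by exists (fun=> b).
  by have [g ? ?] := card_le_injfun b (FB j Dj); exists g.
have /choice[k kP] : forall x, exists i, (\bigcup_(i in D) F i) x -> D i /\ F i x.
  move=> y; have [[j Dj Fy]|nF] := pselect ((\bigcup_(i in D) F i) y).
    by exists j.
  by exists i.
apply: (@card_le_set_inj _ _ _ _ (fun x => (f (k x), g (k x) x))) => [y /kP[Dk Fk]|].
  by split; [exact: fA|exact: (gP _ Dk).1].
move=> y z /set_mem/kP[Dy Fy] /set_mem/kP[Dz Fz] [].
move=> /(finj _ _ (mem_set Dy) (mem_set Dz)) yz.
by rewrite -yz in Fz *; apply: (gP _ Dy).2; apply: mem_set.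
Qed.

Lemma card_setU_le (T K : Type) (A B : set T) (C : set K) :
  infinite_set C -> C `*` C #<= C -> A #<= C -> B #<= C -> A `|` B #<= C.
Proof.
move=> infC CC AC BC; apply: card_le_trans CC; rewrite -bigcup2E.
apply: (@card_bigcup_le _ _ _ _ [set: nat]).
  exact/infiniteP.
by move=> [|[|i]] _ //=; exact: card_ge0.
Qed.

(* Zorn's lemma on the graphs of injections B * B -> B with B `<=` A infinite. *)
Lemma infinite_setX_card (T : Type) (A : set T) :
  infinite_set A -> A `*` A #<= A.
Proof.
move=> infA.
(* [dom G] recovers the underlying set B from the diagonal of B * B. *)
pose dom (G : set (T * T * T)) := [set x | exists z, G ((x, x), z)].
pose Q (G : set (T * T * T)) := [/\
  forall p z, G (p, z) -> [/\ dom G p.1, dom G p.2, dom G z & A p.1],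
  forall x y, dom G x -> dom G y -> exists z, G ((x, y), z),
  forall p z z', G (p, z) -> G (p, z') -> z = z',
  forall p p' z, G (p, z) -> G (p', z) -> p = p' &
  G !=set0 -> infinite_set (dom G)].
have domS G G' : G `<=` G' -> dom G `<=` dom G' by move=> GG' x [z /GG']; exists z.
have Qinj B : infinite_set B -> B `<=` A -> B `*` B #<= B ->
    exists2 G, Q G & dom G = B.
  move=> infB BA BB.
  have [b Bb] := infinite_setN0 infB.
  have [f fB finj] := card_le_injfun b BB.
  pose G := [set q : T * T * T | [/\ B q.1.1, B q.1.2 & q.2 = f q.1]].
  have domG : dom G = B.
    by apply/seteqP; split=> [x [z []]|x Bx]//; exists (f (x, x)).
  exists G => //; rewrite /Q domG; split.
  - move=> p _ [/= B1 B2 ->]; have Bf : B (f p) by apply: fB.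
    by split=> //; exact: BA.
  - by move=> x y Bx By; exists (f (x, y)).
  - by move=> p z z' [_ _ /= ->] [_ _ /= ->].
  - move=> p p' z [/= ? ? ->] [/= ? ? pp'].
    by apply: finj pp'; apply: mem_set; split.
  - by [].
have [F FQ totF|G [[Gdom Gtot Gfun Ginj Ginf] Gmax]] := @Zorn_bigcup _ Q.
  have two q q' : (\bigcup_(X in F) X) q -> (\bigcup_(X in F) X) q' ->
      exists X, [/\ F X, X q & X q'].
    move=> [X FX Xq] [X' FX' Xq']; have [XX'|XX'] := totF _ _ FX FX'.
      by exists X'; split=> //; exact: XX'.
    by exists X; split=> //; exact: XX'.
  split.
  - move=> p z [X FX Xpz]; have [/(_ _ _ Xpz)[? ? ? ?] _ _ _ _] := FQ _ FX.
    have XF : X `<=` \bigcup_(X in F) X by exact: bigcup_sup.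
    by split=> //; exact: domS XF _ _.
  - move=> x y [z xz] [z' yz']; have [X [FX Xx Xy]] := two _ _ xz yz'.
    have [_ Xtot _ _ _] := FQ _ FX.
    have [||w Xw] := Xtot x y; [by exists z|by exists z'|].
    by exists w, X.
  - move=> p z z' pz pz'; have [X [FX Xz Xz']] := two _ _ pz pz'.
    by have [_ _ H _ _] := FQ _ FX; exact: H Xz Xz'.
  - move=> p p' z pz pz'; have [X [FX Xz Xz']] := two _ _ pz pz'.
    by have [_ _ _ H _] := FQ _ FX; exact: H Xz Xz'.
  - move=> [q [X FX Xq]]; have [_ _ _ _ H] := FQ _ FX.
    have /domS : X `<=` \bigcup_(X in F) X by exact: bigcup_sup.
    by move=> /sub_infinite_set; apply; apply: H; exists q.
have infG : infinite_set (dom G).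
  (* Were [G] empty, a countably infinite subset of [A] with a pairing function would give a larger
     graph. *)
  apply: Ginf; apply/set0P/eqP => G0.
  have /infiniteP/card_subP[N Nnat NA] := infA.
  have infN : infinite_set N.
    by apply/infiniteP; have /card_eqPle[] := Nnat.
  have [|H QH domH] := Qinj N infN NA.
    have /card_eqPle[Nn nN] := Nnat.
    apply: card_le_trans (card_le_setX Nn Nn) _; rewrite setXTT.
    by apply: card_le_trans nN; have /card_eqPle[] := card_nat2.
  apply: (Gmax H) => //; rewrite G0; split; first exact: sub0set.
  by move=> H0; have [x] := infinite_setN0 infN; rewrite -domH => -[z /H0].
set B := dom G in infG *.
have BA : B `<=` A by move=> x [z /Gdom[]].
have [b Bb] := infinite_setN0 infG.
have BB : B `*` B #<= B.
  have /choice[f fP] : forall p, exists z, (B `*` B) p -> G (p, z).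
    move=> [x y]; have [[Bx By]|nBB] := pselect ((B `*` B) (x, y)).
      by have [z ?] := Gtot x y Bx By; exists z.
    by exists b.
  apply: (@card_le_set_inj _ _ _ _ f) => [p /fP/Gdom[]//|p q].
  move=> /set_mem/fP Gp /set_mem/fP Gq pq.
  by rewrite pq in Gp; exact: Ginj Gp Gq.
(* If the complement of [B] in [A] is no larger than [B], then [A] injects into [B]. Otherwise the
   complement contains a copy [C] of [B], and [G] extends by an injection of the new pairs into [C],
   against maximality. *)
have [AB|] := card_le_total (A `\` B) B.
  have {}AB : A #<= B.
    by rewrite -(setDUK BA); apply: card_setU_le.
  apply: card_le_trans (card_le_setX AB AB) _; apply: card_le_trans BB _.
  exact: subset_card_le.
move=> /card_subP[C /card_eqPle[CB BC] CAB].
have EC : (B `|` C) `*` (B `|` C) #<= C.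
  have EB : B `|` C #<= B by exact: card_setU_le.
  by apply: card_le_trans (card_le_setX EB EB) _; exact: card_le_trans BB BC.
have [c Cc] : C !=set0.
  apply/set0P/eqP => C0; move: BC; rewrite C0 => /card_le0P B0.
  by rewrite B0 in Bb.
have [f fC finj] := card_le_injfun c EC.
pose H := [set q : T * T * T | [/\ (B `|` C) q.1.1, (B `|` C) q.1.2,
  ~ (B `*` B) q.1 & q.2 = f q.1]].
have nBC x : C x -> ~ B x by move=> /CAB[].
have nGH p z z' : G (p, z) -> H (p, z') -> False.
  by move=> /Gdom[? ? _ _] [/= _ _ +] _; apply.
have nGHz p p' z : G (p, z) -> H (p', z) -> False.
  move=> /Gdom[_ _ Bz _] [/= E1 E2 _ zE].
  by apply: nBC Bz; rewrite zE; apply: fC; split.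
have domGH : dom (G `|` H) = B `|` C.
  apply/seteqP; split=> x.
    by move=> [z [Gz|[]//]]; left; exists z.
  move=> [[z Gz]|Cx]; first by exists z; left.
  exists (f (x, x)); right; split=> //=; [by right|by right|].
  by move=> [/(nBC _ Cx)].
exfalso; apply: (Gmax (G `|` H)).
  split; first exact: subsetUl.
  move=> /domS /(_ c); rewrite domGH => /(_ (or_intror Cc)); exact: nBC.
rewrite /Q domGH; split.
- move=> p z [/Gdom[? ? ? ?]|[/= E1 E2 _ ->]]; first by split=> //; left.
  split=> //; first by right; apply: fC; split.
  by case: E1 => [/BA//|/CAB[]].
- move=> x y Ex Ey; have [[Bx By]|nB] := pselect ((B `*` B) (x, y)).
    by have [z Gz] := Gtot x y Bx By; exists z; left.
  by exists (f (x, y)); right.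
- move=> p z z' [Gz|Hz] [Gz'|Hz'].
  + exact: Gfun Gz Gz'.
  + by case: (nGH _ _ _ Gz Hz').
  + by case: (nGH _ _ _ Gz' Hz).
  + by move: Hz Hz' => [_ _ _ /= ->] [_ _ _ /= ->].
- move=> p p' z [Gz|Hz] [Gz'|Hz'].
  + exact: Ginj Gz Gz'.
  + by case: (nGHz _ _ _ Gz Hz').
  + by case: (nGHz _ _ _ Gz' Hz).
  + move: Hz Hz' => [/= E1 E2 _ ->] [/= E3 E4 _ ff].
    by apply: finj ff; apply: mem_set; split.
- by move=> _; apply: sub_infinite_set infG; exact: subsetUl.
Qed.

Lemma card_bigcup_infinite (I T K : Type) (D : set I) (F : I -> set T) (C : set K) :
  infinite_set C -> D #<= C -> (forall i, D i -> F i #<= C) ->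
  \bigcup_(i in D) F i #<= C.
Proof.
move=> infC DC FC; apply: card_le_trans (infinite_setX_card infC).
exact: card_bigcup_le.
Qed.

Lemma countable_card_infinite (T K : Type) (D : set T) (C : set K) :
  infinite_set C -> countable D -> D #<= C.
Proof. by move=> /infiniteP natC cD; exact: card_le_trans cD natC. Qed.

(** Induction on the length: nonempty lists are images of pairs of a head and a shorter tail. Then
    take the union over all lengths. *)
Lemma card_seq_infinite (T : eqType) (K : Type) (D : set T) (C : set K) :
  infinite_set C -> D #<= C ->
  [set s : seq T | forall x, x \in s -> D x] #<= C.
Proof.
move=> infC DC.
pose L n := [set s : seq T | size s = n /\ forall x, x \in s -> D x].
have LC n : L n #<= C.
  elim: n => [|n IHn].
    apply: countable_card_infinite => //; apply: sub_countable (countable1 [::]).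
    by apply: subset_card_le => -[|x s] [].
  apply: card_le_trans (infinite_setX_card infC).
  apply: card_le_trans (card_le_setX DC IHn).
  apply: card_le_trans (card_image_le (fun p => p.1 :: p.2) _).
  apply: subset_card_le => -[|x s] [//= [sn] sD]; exists (x, s) => //=.
  split; first by apply: sD; rewrite mem_head.
  by split=> // y ys; apply: sD; rewrite in_cons ys orbT.
apply: (@card_le_trans _ _ _ (\bigcup_n L n)).
  by apply: subset_card_le => s sD; exists (size s).
by apply: card_bigcup_infinite => //; exact: countable_card_infinite.
Qed.

(** All values of [g] are adjoined in omega many stages. A finite list lies in a single stage, so
    its values appear in the next one; as [J] is countable and each value is a finite list, no stage
    outgrows [C]. *)
Lemma card_skolem_hull (T : eqType) (J : countType) (K : Type)
    (g : seq T -> J -> seq T) (D : set T) (C : set K) :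
  infinite_set C -> D #<= C ->
  exists H : set T, [/\ D `<=` H, H #<= C &
    forall a j, (forall x, x \in a -> H x) -> forall x, x \in g a j -> H x].
Proof.
move=> infC DC.
pose S (B : set T) := [set s : seq T | forall x, x \in s -> B x].
pose step (B : set T) :=
  B `|` \bigcup_(s in S B) \bigcup_(j in [set: J]) [set` g s j].
pose it n := iter n step D.
have itC n : it n #<= C.
  elim: n => [//|n IHn]; apply: card_setU_le => //.
    exact: infinite_setX_card.
  apply: card_bigcup_infinite => // [|s _].
    exact: card_seq_infinite.
  apply: card_bigcup_infinite => // [|j _].
    exact/countable_card_infinite/countableP.
  exact/countable_card_infinite/finite_set_countable/finite_seq.
have itS m n : m <= n -> it m `<=` it n.
  elim: n => [|n IHn]; first by rewrite leqn0 => /eqP ->.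
  rewrite leq_eqVlt => /orP[/eqP -> //|/IHn mn].
  by apply: subset_trans mn _; exact: subsetUl.
exists (\bigcup_n it n); split.
- by move=> x Dx; exists 0.
- by apply: card_bigcup_infinite => //; exact: countable_card_infinite.
- move=> a j aH x xg.
  have [n an] : exists n, S (it n) a.
    elim: a aH {xg} => [|y a IHa] aH; first by exists 0.
    have [|n an] := IHa; first by move=> z za; apply: aH; rewrite in_cons za orbT.
    have [m _ ym] := aH y (mem_head _ _).
    exists (maxn m n) => z; rewrite in_cons => /orP[/eqP ->|/an].
      by apply: itS ym; exact: leq_maxl.
    by apply: itS; exact: leq_maxr.
  by exists n.+1 => //; right; exists a => //; exists j.
Qed.

(** * Almost retracts *)

Local Open Scope ring_scope.

Lemma mdist_quadrilateral (R : realType) (X : metricType R) (x y x' y' : X) :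
  `|mdist x' y' - mdist x y| <= mdist x' x + mdist y' y.
Proof.
have := metric_triangle x' x y'; have := metric_triangle x y y'.
have := metric_triangle x x' y; have := metric_triangle x' y' y.
rewrite (metric_sym x x') (metric_sym y y') => ? ? ? ?.
by rewrite ler_norml; apply/andP; split; lra.
Qed.

Lemma closure_mdistP (R : realType) (X : metricType R) (A : set X) (x : X) :
  closure A x <-> forall e : R, 0 < e -> exists2 y, A y & mdist x y < e.
Proof.
split=> [clA e e0|H B].
  have [|y [Ay]] := clA (ball x e); first exact: nbhsx_ballx.
  by rewrite ballEmdist => ?; exists y.
rewrite -metricType_numDomainType.nbhs_nbhs_mdist => -[e /= e0 eB].
by have [y Ay xy] := H e e0; exists y; split=> //; exact: eB.
Qed.

(* Unlike ai_local_retract, this tolerates an error on E `&` Y, hence passes to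
   closures. *)
Definition almost_retract (R : realType) (X : metricType R) (Y : set X) : Prop :=
  forall (E : set X) (eta : R), finite_set E -> 0 < eta ->
    exists T : X -> X,
      [/\ set_fun E Y T,
          forall x, (E `&` Y) x -> mdist (T x) x <= eta &
          forall x y, E x -> E y -> `|mdist (T x) (T y) - mdist x y| <= eta].

Lemma up_directed_finite (T : Type) (A : set (set T)) (E : set T) :
  up_directed A -> finite_set E -> E `<=` \bigcup_(B in A) B ->
  exists2 B, A B & E `<=` B.
Proof.
elim/Pchoice: T => T in A E *.
move=> [[B0 AB0] Adir] /finite_seqP[s ->].
elim: s => [|x s IHs] sA; first by exists B0.
have [|B AB sB] := IHs.
  by move=> y ys; apply: sA; rewrite /= in_cons ys orbT.
have [C AC Cx] : (\bigcup_(B in A) B) x by apply: sA; rewrite /= mem_head.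
have [D AD BCD] := Adir _ _ AB AC; exists D => // y /=.
by rewrite in_cons => /orP[/eqP ->|/sB By]; apply: BCD; [right|left].
Qed.

(** The points of [E] in the closure are first moved into the union, hence into a single member [B],
    and the moved set is then almost retracted into [B]. Moving each of two points and retracting
    cost a third of [eta] apiece. *)
Lemma almost_retract_closure_bigcup (R : realType) (X : metricType R)
    (A : set (set X)) :
  up_directed A -> (forall B, A B -> almost_retract B) ->
  almost_retract (closure (\bigcup_(B in A) B)).
Proof.
move=> Adir Aret E eta finE eta0; pose U := \bigcup_(B in A) B.
have d0 : 0 < eta / 3 by lra.
have /choice[p pP] : forall x, exists x', mdist x' x <= eta / 3 /\
    if x \in closure U then U x' else x' = x.
  move=> x; have [/set_mem/closure_mdistP/(_ _ d0)[y Uy /ltW xy]|_] := boolP (x \in _).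
    by exists y; rewrite metric_sym.
  by exists x; rewrite mdistxx ltW.
have [|B AB pB] := up_directed_finite Adir (finite_image p (finite_setIl (closure U) finE)).
  by move=> _ [x [_ /mem_set xU] <-]; have [_] := pP x; rewrite xU.
have [T [TB Tid Tdist]] := Aret B AB _ _ (finite_image p finE) d0.
exists (T \o p); split=> [x Ex|x [Ex clx]|x y Ex Ey] /=.
- by apply: subset_closure; exists B => //; apply: TB; exists x.
- have Bpx : B (p x) by apply: pB; exists x.
  have Tpx : mdist (T (p x)) (p x) <= eta / 3 by apply: Tid; split=> //; exists x.
  have [px _] := pP x; have := metric_triangle (T (p x)) (p x) x; lra.
- have /(_ (ex_intro2 _ _ x Ex erefl) (ex_intro2 _ _ y Ey erefl)) :=
    Tdist (p x) (p y).
  have := mdist_quadrilateral x y (p x) (p y).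
  have [px _] := pP x; have [py _] := pP y.
  rewrite !ler_norml => /andP[? ?] /andP[? ?]; apply/andP; split; lra.
Qed.

Lemma finite_mdist_separated (R : realType) (X : metricType R) (E : set X) :
  finite_set E -> exists2 m : R, 0 < m &
    forall x y, E x -> E y -> x != y -> m <= mdist x y.
Proof.
move=> /finite_seqP[s ->].
(* The neutral value 1 covers sets without two distinct points. *)
exists (\big[Order.min/1]_(p <- [seq (x, y) | x <- s, y <- s] | p.1 != p.2) mdist p.1 p.2).
  by apply: lt_bigmin => // p; rewrite mdist_gt0.
move=> x y xs ys xy; apply: (@ge_bigmin_seq _ _ _ _ _ (x, y)) => //.
by apply: allpairs_f.
Qed.

(** An additive error that is small against the least distance in [E] is a small multiplicative one.
    The map may then be overridden by the identity on [Y]. *)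
Lemma almost_retract_ai_local_retract (R : realType) (X : metricType R) (Y : set X) :
  almost_retract Y -> ai_local_retract Y.
Proof.
move=> Yret E eps finE eps0.
have [m m0 mE] := finite_mdist_separated finE.
have e1 : 0 < 1 + eps by lra.
(* Chosen so that 1 - c is the inverse of 1 + eps; as c <= eps, a relative error c respects both
   bounds. *)
pose c := eps / (1 + eps).
have c0 : 0 < c by rewrite divr_gt0.
have ceps : c <= eps by rewrite ler_pdivrMr //; nra.
have c1 : (1 + eps)^-1 = 1 - c by rewrite /c; field; rewrite gt_eqF.
(* One third is for [T], and one for each of the two points where [T'] may differ from [T]. *)
have eta0 : 0 < c * m / 3 by rewrite divr_gt0// mulr_gt0.
have [T [TY Tid Tdist]] := Yret E _ finE eta0.
pose T' x := if x \in Y then x else T x.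
have T'T x : E x -> mdist (T' x) (T x) <= c * m / 3.
  move=> Ex; rewrite /T'; case: ifPn => [/set_mem Yx|_].
    by rewrite metric_sym; exact: Tid.
  by rewrite mdistxx ltW.
exists T'; split=> [x Ex|x [_ /mem_set Yx]|x y Ex Ey].
- by rewrite /T'; case: ifPn => [/set_mem//|_]; exact: TY.
- by rewrite /T' Yx.
- have [->|xy] := eqVneq x y; first by rewrite !mdistxx !mulr0 lexx.
  have := mdist_quadrilateral (T x) (T y) (T' x) (T' y).
  have := Tdist x y Ex Ey; have := T'T x Ex; have := T'T y Ey.
  have := mE x y Ex Ey xy; rewrite c1 => mxy.
  have : c * m <= c * mdist x y by rewrite ler_pM2l.
  have : c * mdist x y <= eps * mdist x y.
    by rewrite ler_wpM2r// mdist_ge0.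
  rewrite !ler_norml => ? ? ? ? /andP[? ?] /andP[? ?]; apply/andP; split; lra.
Qed.

(* For fixed k, this takes countably many values and determines the distances up
   to 1 / k. *)
Definition dist_profile (R : realType) (X : metricType R) (k : nat) (s : seq X) :
    seq (seq int) :=
  [seq [seq Num.floor (k%:R * mdist x y) | y <- s] | x <- s].

Lemma dist_profile_close (R : realType) (X : metricType R) (k : nat)
    (x0 : X) (s t : seq X) (i j : nat) :
  dist_profile k s = dist_profile k t -> (i < size s)%N -> (j < size s)%N ->
  k%:R * `|mdist (nth x0 t i) (nth x0 t j) - mdist (nth x0 s i) (nth x0 s j)| <= 1.
Proof.
move=> st si sj.
have sz : size t = size s by have /(congr1 size) := st; rewrite !size_map.
have /(congr1 (fun u => nth 0 (nth [::] u i) j)) := st.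
rewrite !(nth_map x0) ?sz// => fl.
have := floor_itv (k%:R * mdist (nth x0 s i) (nth x0 s j)).
have := floor_itv (k%:R * mdist (nth x0 t i) (nth x0 t j)).
rewrite fl intrD => /andP[? ?] /andP[? ?].
rewrite -{1}(@ger0_norm _ k%:R)// -normrM mulrBr ler_norml.
by apply/andP; split; lra.
Qed.

(** The Skolem function answers a list [a] and a profile realized by some extension of [a] with one
    chosen such extension; precisions and profiles form a countable type. A finite set splits into
    [a] inside the hull and [e] outside, and the answer replaces [e]. *)
Lemma almost_retract_hull (R : realType) (X : metricType R) (K : Type)
    (D : set X) (C : set K) :
  infinite_set C -> (D #<= C) ->
  exists H : set X, [/\ D `<=` H, H #<= C & almost_retract H].
Proof.
move=> infC DC.
have /choice[g gP] : forall aj : seq X * (nat * seq (seq int)), exists e,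
    forall e', dist_profile aj.2.1 (aj.1 ++ e') = aj.2.2 ->
    dist_profile aj.2.1 (aj.1 ++ e) = aj.2.2.
  move=> aj.
  have [[e He]|ne] := pselect (exists e, dist_profile aj.2.1 (aj.1 ++ e) = aj.2.2).
    by exists e.
  by exists [::] => e' He'; case: ne; exists e'.
have [H [DH HC Hg]] := card_skolem_hull (fun a j => g (a, j)) infC DC.
exists H; split=> // E eta /finite_seqP[s ->] eta0.
pose a := [seq x <- s | x \in H]; pose e := [seq x <- s | x \notin H].
(* [k] exceeds 1 / eta, so an error of 1 / k is at most [eta]. *)
pose k := (Num.truncn eta^-1).+1.
have keta : 1 <= k%:R * eta.
  by rewrite -ler_pdivrMr// div1r ltW// truncnS_gt.
pose e' := g (a, (k, dist_profile k (a ++ e))).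
have /esym prof : dist_profile k (a ++ e') = dist_profile k (a ++ e).
  exact: gP (a, (k, dist_profile k (a ++ e))) e erefl.
have sz : size (a ++ e') = size (a ++ e).
  by have /(congr1 size) := prof; rewrite !size_map.
have aH x : x \in a -> H x by rewrite mem_filter => /andP[/set_mem].
have se x : x \in s -> x \in a ++ e.
  by rewrite mem_cat !mem_filter => ->; rewrite !andbT orbN.
(* The entries of [a] come first in both lists and keep their positions, so [T] fixes them. *)
pose T x := nth x (a ++ e') (index x (a ++ e)).
exists T; split=> [x xs|x [xs Hx]|x y xs ys].
- have : T x \in a ++ e' by rewrite mem_nth// sz index_mem se.
  rewrite mem_cat => /orP[/aH//|]; exact: Hg.
- have xa : x \in a by rewrite mem_filter mem_set.
  rewrite /T index_cat xa nth_cat index_mem xa nth_index// mdistxx.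
  exact: ltW.
- have xi : (index x (a ++ e) < size (a ++ e))%N by rewrite index_mem se.
  have yi : (index y (a ++ e) < size (a ++ e))%N by rewrite index_mem se.
  have := dist_profile_close x prof xi yi.
  rewrite !nth_index ?se// /T (set_nth_default x y) ?sz// => kd.
  by rewrite -(@ler_pM2l _ k%:R)// (le_trans kd).
Qed.

(** * Gluing along a closed subset *)

Lemma isometric_embedding_inj (R : realType) (X M : metricType R) (f : X -> M) :
  isometric_embedding f -> injective f.
Proof.
by move=> fiso x y fxy; apply: mdist_positivity; rewrite -fiso fxy mdistxx.
Qed.

Section gluing.
Context {R : realType} {X M : metricType R} (Y : set X) (f : Y -> M).
Context (Y0 : Y !=set0) (Ycl : closed Y) (fiso : isometric_embedding f).

Let fisoE (y y' : Y) : mdist (f y) (f y') = mdist (\val y) (\val y').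
Proof. exact: fiso. Qed.

(* X and M glued along Y: the points of M that belong to Y are dropped. *)
Definition gluing := (X + ~` range f)%type.

(** The amalgam distance: the infimum of the lengths of routes from [x] to [m] through a point of
    [Y]. *)
Definition gluing_cross (x : X) (m : M) : R :=
  inf [set mdist x (\val y) + mdist (f y) m | y in [set: Y]].

Lemma gluing_cross_le x m y : gluing_cross x m <= mdist x (\val y) + mdist (f y) m.
Proof.
apply: ge_inf; last by exists y.
by exists 0 => _ [z _ <-]; rewrite addr_ge0// mdist_ge0.
Qed.

Lemma gluing_cross_ge x m c :
  (forall y, c <= mdist x (\val y) + mdist (f y) m) -> c <= gluing_cross x m.
Proof.
move=> H; apply: lb_le_inf => [|_ [y _ <-]//].
have [y Yy] := Y0; exists (mdist x y + mdist (f (SigSub (mem_set Yy))) m).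
by exists (SigSub (mem_set Yy)).
Qed.

(** Here closedness enters: a zero distance puts [x] in the closure of [Y], hence in [Y], and then
    [m] is the image of [x]. The dropped points are thus exactly those that would coincide with
    points of [X]. *)
Lemma gluing_cross_eq0 x m : gluing_cross x m = 0 -> range f m.
Proof.
move=> xm0; have Yx : Y x.
  apply: Ycl; apply/closure_mdistP => e e0; apply: contrapT => ne.
  have : e <= gluing_cross x m.
    apply: gluing_cross_ge => y; rewrite leNgt; apply/negP => ye.
    apply: ne; exists (\val y); first exact: set_valP.
    by apply: le_lt_trans ye; rewrite lerDl mdist_ge0.
  by rewrite xm0 leNgt e0.
exists (SigSub (mem_set Yx)) => //; apply: mdist_positivity; apply/eqP.
rewrite eq_le mdist_ge0 andbT -xm0; apply: gluing_cross_ge => y.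
apply: le_trans (metric_triangle _ (f y) _) _.
by rewrite lerD2r fiso.
Qed.

Lemma gluing_crossDl x x' m : gluing_cross x m <= mdist x x' + gluing_cross x' m.
Proof.
rewrite -lerBlDl; apply: gluing_cross_ge => y; rewrite lerBlDl addrA.
apply: le_trans (gluing_cross_le _ _ y) _.
by rewrite lerD2r metric_triangle.
Qed.

Lemma gluing_crossDr x m m' : gluing_cross x m <= gluing_cross x m' + mdist m' m.
Proof.
rewrite -lerBlDr; apply: gluing_cross_ge => y; rewrite lerBlDr -addrA.
apply: le_trans (gluing_cross_le _ _ y) _.
by rewrite lerD2l metric_triangle.
Qed.

(** For routes through [y] and [y'], the isometry [f] turns the distance between [y] and [y'] into
    one in [M], where the detour through [m] bounds it. *)
Lemma gluing_cross_mdistl x x' m : mdist x x' <= gluing_cross x m + gluing_cross x' m.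
Proof.
rewrite -lerBlDr; apply: gluing_cross_ge => y.
rewrite lerBlDr -lerBlDl; apply: gluing_cross_ge => y'.
have := metric_triangle x (\val y) x'; have := metric_triangle (\val y) (\val y') x'.
have := metric_triangle (f y) m (f y').
rewrite fisoE (metric_sym (\val y') x') (metric_sym m (f y')).
lra.
Qed.

Lemma gluing_cross_mdistr x m m' : mdist m m' <= gluing_cross x m + gluing_cross x m'.
Proof.
rewrite -lerBlDr; apply: gluing_cross_ge => y.
rewrite lerBlDr -lerBlDl; apply: gluing_cross_ge => y'.
have := metric_triangle m (f y) m'; have := metric_triangle (f y) (f y') m'.
have := metric_triangle (\val y) x (\val y').
rewrite fisoE (metric_sym (\val y) x) (metric_sym m (f y)).
lra.
Qed.

Definition gluing_dist (u v : gluing) : R :=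
  match u, v with
  | inl x, inl x' => mdist x x'
  | inl x, inr m => gluing_cross x (\val m)
  | inr m, inl x => gluing_cross x (\val m)
  | inr m, inr m' => mdist (\val m) (\val m')
  end.

Lemma gluing_distxx u : gluing_dist u u = 0.
Proof. by case: u => ? /=; rewrite mdistxx. Qed.

Lemma gluing_dist_positivity u v : gluing_dist u v = 0 -> u = v.
Proof.
case: u v => [x|m] [x'|m'] /=; first by move=> /mdist_positivity ->.
- by move=> /gluing_cross_eq0; have := set_valP m'.
- by move=> /gluing_cross_eq0; have := set_valP m.
- by move=> /mdist_positivity/val_inj ->.
Qed.

Lemma gluing_dist_sym u v : gluing_dist u v = gluing_dist v u.
Proof. by case: u v => [x|m] [x'|m'] //=; exact: metric_sym. Qed.

Lemma gluing_dist_triangle v u w :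
  gluing_dist u w <= gluing_dist u v + gluing_dist v w.
Proof.
case: u v w => [x|m] [x'|m'] [x''|m''] /=.
- exact: metric_triangle.
- exact: gluing_crossDl.
- exact: gluing_cross_mdistl.
- exact: gluing_crossDr.
- by rewrite addrC metric_sym; exact: gluing_crossDl.
- exact: gluing_cross_mdistr.
- by rewrite addrC metric_sym; exact: gluing_crossDr.
- exact: metric_triangle.
Qed.

Lemma gluing_isometric : exists (N : metricType R) (i : X -> N) (j : M -> N),
  [/\ isometric_embedding i, isometric_embedding j &
      forall y : Y, i (\val y) = j (f y)].
Proof.
pose N : metricType R := HB.pack gluing (Choice.on gluing)
  (isMetric.Build R gluing gluing_distxx gluing_dist_positivity
    gluing_dist_sym gluing_dist_triangle).
(* A point in the range of [f] goes to its counterpart in [X], its own copy having been dropped; any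
   other point goes to its copy. *)
have /choice[j jP] : forall m, exists u : gluing,
    (exists2 y, f y = m & u = inl (\val y)) \/
    (exists2 m', \val m' = m & u = inr m').
  move=> m; have [[y _ ym]|nm] := pselect (range f m).
    by exists (inl (\val y)); left; exists y.
  pose n : ~` range f := SigSub (mem_set (nm : (~` range f) m)).
  by exists (inr n); right; exists n.
have crossf y m : gluing_cross (\val y) m = mdist (f y) m.
  apply/eqP; rewrite eq_le; apply/andP; split.
    by rewrite -[leRHS]add0r -(mdistxx (\val y)) gluing_cross_le.
  apply: gluing_cross_ge => y'; apply: le_trans (metric_triangle _ (f y') _) _.
  by rewrite lerD2r fiso.
exists N, inl, j; split=> //.
- move=> m m'; rewrite [LHS]/(gluing_dist (j m) (j m')).
  have [[y <- ->]|[n <- ->]] := jP m; have [[y' <- ->]|[n' <- ->]] := jP m' => /=.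
  + by rewrite fiso.
  + by rewrite crossf.
  + by rewrite crossf metric_sym.
  + by [].
- move=> y; have [[y' /(isometric_embedding_inj fiso) -> ->]//|[m my]] := jP (f y).
  by have := set_valP m; case; exists y.
Qed.

End gluing.

Lemma ai_local_retract_absolute (R : realType) (X : metricType R) (Y : set X) :
  Y !=set0 -> closed Y -> ai_local_retract Y -> absolute_ai_local_retract X ->
  absolute_ai_local_retract (set_type Y).
Proof.
move=> Y0 Ycl Yret Xabs M f fiso E eps finE eps0.
have [N [i [j [iiso jiso ij]]]] := gluing_isometric Y0 Ycl fiso.
(* From d <= 1 and 3d <= eps follows (1 + d)^2 <= 1 + eps, the distortion of two successive
   retractions. *)
pose d := Num.min 1 (eps / 3).
have d0 : 0 < d by rewrite lt_min ltr01 divr_gt0.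
have d1 : d <= 1 by rewrite ge_min lexx.
have de : d <= eps / 3 by rewrite ge_min lexx orbT.
have [T [TX Tid Tdist]] := Xabs N i iiso (j @` E) d (finite_image j finE) d0.
(* [h] reads the values of [T] back in [X]; its values off [E] do not matter. *)
have /choice[h hP] : forall m, exists x, E m -> i x = T (j m).
  move=> m; have [Em|nE] := pselect (E m).
    by have [|x _ xT] := TX (j m); [exists m|exists x].
  by have [y _] := Y0; exists y.
have [S [SY Sid Sdist]] := Yret (h @` E) d (finite_image h finE) d0.
have /choice[q qP] : forall x, exists y : Y, Y x -> \val y = x.
  move=> x; have [Yx|nY] := pselect (Y x); first by exists (SigSub (mem_set Yx)).
  by have [y Yy] := Y0; exists (SigSub (mem_set Yy)).
exists (fun m => f (q (S (h m)))); split=> [m Em|m [Em [y _ ym]]|m m' Em Em'].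
- by exists (q (S (h m))).
- have hy : h m = \val y.
    apply: (isometric_embedding_inj iiso); rewrite hP// ij ym; apply: Tid.
    by split; [exists m|exists (\val y) => //; rewrite ij ym].
  have Yy : Y (\val y) by exact: set_valP.
  rewrite hy Sid ?qP//.
    by rewrite -ym; congr f; apply: val_inj; rewrite qP.
  by split=> //; exists m.
- rewrite fiso [mdist (q _) _]/(mdist (\val (q _)) (\val (q _))).
  rewrite !qP; [|by apply: SY; exists m'|by apply: SY; exists m].
  have := Sdist (h m) (h m') (ex_intro2 _ _ m Em erefl) (ex_intro2 _ _ m' Em' erefl).
  have := Tdist (j m) (j m') (ex_intro2 _ _ m Em erefl) (ex_intro2 _ _ m' Em' erefl).
  rewrite -!hP// iiso jiso => /andP[Tl Tu] /andP[Sl Su].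
  have dd : (1 + d) * (1 + d) <= 1 + eps by nra.
  have c0 : 0 < 1 + d by lra.
  have D0 := mdist_ge0 m m'.
  apply/andP; split.
    apply: le_trans Sl; apply: (@le_trans _ _ ((1 + d)^-1 * ((1 + d)^-1 * mdist m m'))).
      rewrite mulrA ler_wpM2r// -invfM lef_pV2// posrE ?mulr_gt0//; lra.
    by rewrite ler_pM2l ?invr_gt0.
  apply: le_trans Su _; apply: (@le_trans _ _ ((1 + d) * ((1 + d) * mdist m m'))).
    by rewrite ler_pM2l.
  by rewrite mulrA ler_wpM2r.
Qed.

(** * Density *)

Lemma exists_realizes_dens (Z : topologicalType) : exists D : set Z, realizes_dens D.
Proof.
have [|D Dd Dmin] := @card_le_min Z [set D | dense D]; last by exists D.
by exists setT => O; rewrite setIT.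
Qed.

Lemma dense_mdistP (R : realType) (Z : metricType R) (D : set Z) :
  dense D <-> forall x (e : R), 0 < e -> exists2 y, D y & mdist x y < e.
Proof.
split=> [Dd x e e0|H O [x Ox] oO].
  have [||y [yb Dy]] := Dd (ball x e)^°.
  - by exists x; apply: nbhs_singleton; apply: nbhs_interior; exact: nbhsx_ballx.
  - exact: open_interior.
  - by exists y => //; have := interior_subset yb; rewrite ballEmdist.
have /closure_mdistP clx : forall e : R, 0 < e -> exists2 y, D y & mdist x y < e.
  exact: H.
have [|y [Dy Oy]] := clx O; first exact: open_nbhs_nbhs.
by exists y.
Qed.

Lemma finite_set_metric_closed (R : realType) (X : metricType R) (A : set X) :
  finite_set A -> closed A.
Proof.
move: A; apply/accessible_finite_set_closed.
by apply: hausdorff_accessible; exact: metric_hausdorff.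
Qed.

(* Each pair (s, n) with s in DS picks a point of Y at distance < 1/(n+1) from
   s, when there is one. *)
Lemma realizes_dens_subset (R : realType) (X : metricType R) (Y S : set X)
    (DY : set Y) (DS : set S) :
  Y `<=` S -> realizes_dens DY -> dense DS -> infinite_set DS -> DY #<= DS.
Proof.
move=> YS [_ DYmin] /dense_mdistP dDS infDS.
have /choice[B BP] : forall sn : S * nat, exists B : set Y, finite_set B /\
    forall y : Y, mdist (\val sn.1) (\val y) < sn.2.+1%:R^-1 :> R ->
    exists2 y', B y' & mdist (\val sn.1) (\val y') < sn.2.+1%:R^-1 :> R.
  move=> sn.
  have [[y sy]|ny] := pselect (exists y : Y, mdist (\val sn.1) (\val y) < sn.2.+1%:R^-1 :> R).
    by exists [set y]; split=> // ? _; exists y.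
  by exists set0; split=> // y sy; case: ny; exists y.
pose D := \bigcup_(s in DS) \bigcup_n B (s, n).
apply: (@card_le_trans _ _ _ D).
  apply: DYmin; apply/dense_mdistP => y e e0.
  (* This gives 2 / (n + 1) < e, one half for the way from [y] to [s] and one for the way from [s]
     to [y']. *)
  pose n := Num.truncn (2 / e).
  have ne : 2 * n.+1%:R^-1 < e.
    by rewrite ltr_pdivrMr// mulrC -ltr_pdivrMr// truncnS_gt.
  have n0 : 0 < n.+1%:R^-1 :> R by rewrite invr_gt0.
  have Sy : S (\val y) by apply: YS; exact: set_valP.
  have [s DSs /= ys] := dDS (SigSub (mem_set Sy)) _ n0.
  have {}ys : mdist (\val s) (\val y) < n.+1%:R^-1 by rewrite metric_sym.
  have [y' By' sy'] := (BP (s, n)).2 y ys.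
  exists y'; first by exists s => //; exists n.
  rewrite -[mdist _ _]/(mdist (\val y) (\val y')).
  apply: le_lt_trans (metric_triangle _ (\val s) _) _; apply: lt_trans ne.
  rewrite mulr_natl mulr2n; apply: ltrD; last exact: sy'.
  by rewrite metric_sym; exact: ys.
apply: card_bigcup_infinite => // s _.
apply: card_bigcup_infinite => // [|n _].
  exact: countable_card_infinite.
by apply: countable_card_infinite => //; apply: finite_set_countable; exact: (BP _).1.
Qed.

(** The image in [X] of a finite dense subset would be closed, hence would contain [S]. *)
Lemma infinite_dense (R : realType) (X : metricType R) (S : set X) (DS : set S) :
  infinite_set S -> dense DS -> infinite_set DS.
Proof.
move=> infS /dense_mdistP dDS finDS; apply: infS.
have finV : finite_set [set \val x | x in DS] := finite_image _ finDS.
apply: (sub_finite_set _ finV) => x Sx; apply: (finite_set_metric_closed finV).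
apply/closure_mdistP => e e0.
have [y Dy xy] := dDS (SigSub (mem_set Sx)) e e0.
by exists (\val y) => //; exists y.
Qed.

Lemma dense_closure_subtype (R : realType) (X : metricType R) (Y : set X) (D : set Y) :
  dense D -> Y `<=` closure [set \val x | x in D].
Proof.
move=> /dense_mdistP dD y Yy; apply/closure_mdistP => e e0.
have [z Dz yz] := dD (SigSub (mem_set Yy)) e e0.
by exists (\val z) => //; exists z.
Qed.

Lemma dense_in_closure (R : realType) (X : metricType R) (H : set X) :
  dense [set x : closure H | H (\val x)].
Proof.
apply/dense_mdistP => x e e0.
have /closure_mdistP/(_ e e0)[y Hy xy] := set_valP x.
by exists (SigSub (mem_set (subset_closure Hy))).
Qed.

Lemma card_val_image (X : Type) (Y : set X) (D : set Y) : [set \val x | x in D] #= D.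
Proof. by apply: inj_card_eq => x y _ _; exact: val_inj. Qed.

Lemma not_separable_infinite (Z : topologicalType) : ~ separable Z -> infinite_set [set: Z].
Proof.
move=> nsep finZ; apply: nsep; exists setT; first exact: finite_set_countable.
by move=> O; rewrite setIT.
Qed.

(** This reduces the density clause of exceeding richness to hulls that do not outgrow an infinite
    set. The hull is taken over a dense subset of [Y] of least cardinality and a countably infinite
    set, which forces its own density to be infinite. *)
Lemma dens_hull (R : realType) (X : metricType R) (Q : set X -> Prop) :
  infinite_set [set: X] ->
  (forall C D : set X, infinite_set C -> D #<= C ->
    exists H, [/\ D `<=` H, H #<= C & Q (closure H)]) ->
  forall Y : set X, exists S : set X, [/\ closed S /\ Q S, Y `<=` S &
    exists (DY : set Y) (DS : set S),
      [/\ realizes_dens DY, realizes_dens DS & is_card_max DY [set: nat] DS]].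
Proof.
move=> /infiniteP/card_subP[N /card_eqPle[Nnat natN] _] hull Y.
have infN : infinite_set N by apply/infiniteP.
have [DY rDY] := exists_realizes_dens Y.
pose DY' := [set \val x | x in DY].
have /card_eqPle[DY'DY DYDY'] := card_val_image DY.
(* [C] represents the maximum of dens Y and omega inside [X]. *)
have [C [infC DC CDY]] : exists C : set X, [/\ infinite_set C, DY' `|` N #<= C &
    C #<= DY \/ C #<= [set: nat]].
  have [finDY|infDY] := pselect (finite_set DY').
    exists N; split=> //; last by right.
    apply: card_setU_le => //; first exact: infinite_setX_card.
    exact/countable_card_infinite/finite_set_countable.
  exists DY'; split=> //; last by left.
  apply: card_setU_le => //; first exact: infinite_setX_card.
  exact: countable_card_infinite.
have [H [DH HC QH]] := hull _ _ infC DC.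
exists (closure H).
have YS : Y `<=` closure H.
  apply: subset_trans (dense_closure_subtype rDY.1) _.
  by apply: closure_subset => x DYx; apply: DH; left.
split=> //; first by split=> //; exact: closed_closure.
have [DS rDS] := exists_realizes_dens (closure H).
have infDS : infinite_set DS.
  apply: infinite_dense rDS.1; apply: sub_infinite_set infN => x Nx.
  by apply/subset_closure/DH; right.
have DSC : DS #<= C.
  apply: card_le_trans HC; apply: card_le_trans (rDS.2 _ (@dense_in_closure _ _ H)) _.
  have /card_eqPle[_ h] := card_val_image [set x : closure H | H (\val x)].
  by apply: card_le_trans h _; apply: subset_card_le => _ [x Hx <-].
exists DY, DS; split=> //; split.
- exact: realizes_dens_subset rDS.1 infDS.
- exact/infiniteP.
- by case: CDY => CDY; [left|right]; exact: card_le_trans DSC CDY.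
Qed.

(** A single set is an up-directed family. *)
Lemma almost_retract_closure (R : realType) (X : metricType R) (H : set X) :
  almost_retract H -> almost_retract (closure H).
Proof.
move=> Hret; rewrite -(bigcup_set1 id H); apply: almost_retract_closure_bigcup => [|_ ->//].
by split=> [|_ _ -> ->]; [exists H|exists H => //; rewrite setUid].
Qed.

(** * The exceedingly rich family *)

Theorem theorem5 (R : realType) (X : metricType R) (hX : ~ separable X) :
  exists F : set (set X),
    exceedingly_rich F /\
    forall Y : set X, F Y ->
      (absolute_ai_local_retract X <-> absolute_ai_local_retract (set_type Y)).
Proof.
have infX := not_separable_infinite hX.
have [Xabs|nXabs] := pselect (absolute_ai_local_retract X).
  exists [set S | closed S /\ almost_retract S]; split=> [|Y [Ycl Yret]].
    split=> [S []//||A AF Adir].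
      apply: dens_hull => // C D infC DC.
      have [H [DH HC Hret]] := almost_retract_hull infC DC.
      by exists H; split=> //; exact: almost_retract_closure.
    split; first exact: closed_closure.
    by apply: almost_retract_closure_bigcup => // B /AF[].
  split=> // _; apply: ai_local_retract_absolute => //; last first.
    exact: almost_retract_ai_local_retract.
  (* [Y] is nonempty, since it receives the almost retraction of a one-point set. *)
  have [x _] := infinite_setN0 infX.
  by have [T [TY _ _]] := Yret [set x] 1 (finite_set1 x) ltr01; exists (T x); exact: TY.
have [M [f [fiso nret]]] : exists (M : metricType R) (f : X -> M),
    isometric_embedding f /\ ~ ai_local_retract (range f).
  apply: contrapT => nM; apply: nXabs => M f fiso; apply: contrapT => nr.
  by apply: nM; exists M, f.
have [E [eps [finE eps0 nT]]] : exists (E : set M) (eps : R),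
    [/\ finite_set E, 0 < eps & ~ exists T : M -> M,
      [/\ set_fun E (range f) T,
          forall x, (E `&` range f) x -> T x = x &
          forall x y, E x -> E y ->
            (1 + eps)^-1 * mdist x y <= mdist (T x) (T y)
              <= (1 + eps) * mdist x y]].
  apply: contrapT => nE; apply: nret => E eps finE eps0; apply: contrapT => nT.
  by apply: nE; exists E, eps.
pose P := f @^-1` E.
have finP : finite_set P.
  apply: finite_preimage finE => x y _ _; exact: isometric_embedding_inj.
exists [set S | closed S /\ P `<=` S]; split=> [|Y [Ycl PY]].
  split=> [S []//||A AF [[B AB] _]].
    apply: dens_hull => // C D infC DC; exists (D `|` P); split.
    - exact: subsetUl.
    - apply: card_setU_le => //; first exact: infinite_setX_card.
      exact/countable_card_infinite/finite_set_countable.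
    - by apply: subset_trans (@subset_closure _ _); exact: subsetUr.
  split; first exact: closed_closure.
  move=> x Px; apply: subset_closure; exists B => //.
  by have [_] := AF _ AB; apply.
(* A retraction of [E] into the image of [Y] is also one into the image of [X]: the points of [E]
   coming from [X] form [P], which lies in [Y], so they stay fixed. *)
split=> // Yabs; exfalso; apply: nT.
have [] := Yabs M (f \o \val) _ E eps finE eps0; first by move=> x y; exact: fiso.
move=> T [TY Tid Tdist]; exists T; split=> // [m Em|m [Em [x _ xm]]].
  by have [y _ <-] := TY m Em; exists (\val y).
apply: Tid; split=> //.
have Yx : Y x by apply: PY; rewrite /P /= xm.
by exists (SigSub (mem_set Yx)).
Qed.
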